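(* Let $T>0$, $\ell>0$. Let $a,f\in C([0,T]\times[-\ell,\ell]\times\mathbb{R}\times\mathbb{R})$ and $b(\cdot,\pm\ell,\cdot,\cdot),\,g(\cdot,\pm\ell,\cdot,\cdot)\in C([0,T]\times\mathbb{R}\times\mathbb{R})$ be real-valued with $a>0$ and $b(\cdot,\pm\ell,\cdot,\cdot)>0$. Let $u^0$ be Lipschitz continuous on $[-\ell,\ell]$, that is, $$|u^0(x)-u^0(y)|\le K|x-y|,\qquad x,y\in[-\ell,\ell].$$ Let $M>0$ and suppose that there are $q_0\ge K$ and $\psi\in C^1([0,\infty),[1,\infty))$ with $$\int_{q_0}^\infty\frac{\rho\,d\rho}{\psi(\rho)}>2M$$ such that $$|f(t,x,z,p)|\le a(t,x,z,p)\,\psi(|p|),\qquad (t,x,z,p)\in\overline{\Omega}_T\times[-M,M]\times\mathbb{R},$$ and such that for all $(t,z)\in(0,T]\times[-M,M]$ and all $p\ge q_0$ $$g(t,\ell,z,p)\le b(t,\ell,z,p)p,\qquad -g(t,\ell,z,-p)\le b(t,\ell,z,-p)p,$$ $$-g(t,-\ell,z,p)\le b(t,-\ell,z,p)p,\qquad g(t,-\ell,z,-p)\le b(t,-\ell,z,-p)p.$$ Then there exists a constant $M_1=M_1(M,\psi,K)$ such that the following holds: if $u$ is any classical solution on $\Omega_\tau$, with $\tau\le T$, to $$u_t-a(t,x,u,u_x)u_{xx}=f(t,x,u,u_x),\qquad (t,x)\in(0,\tau)\times(-\ell,\ell),$$ $$u_t\pm b(t,x,u,u_x)u_x=g(t,x,u,u_x),\qquad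 t\in(0,\tau),\ x=\pm\ell,$$ subject to $u(0,\cdot)=u^0$ on $[-\ell,\ell]$ and satisfying $|u|_{\Omega_\tau}\le M$, then $|u_x|_{\Omega_\tau}\le M_1$.
   Context: $\Omega_\tau=(0,\tau)\times(-\ell,\ell)$ for $\tau>0$; $|v|_{\Omega_\tau}=\sup_{\Omega_\tau}|v|$. The boundary condition with $\pm$ means two conditions, with $+$ at $x=\ell$ and $-$ at $x=-\ell$. A classical solution on $\Omega_\tau$ is a function $u\in C^{1,2}(\Omega_\tau)\cap C(\overline{\Omega}_\tau)$ (that is, $u$ is continuous on $\overline{\Omega}_\tau$ and has continuous derivatives $u_t,u_{xx}$ on $\Omega_\tau$) whose derivatives $u_t(\cdot,\pm\ell)$ and $u_x(\cdot,\pm\ell)$ are defined on $(0,\tau)$ and which satisfies the equation and the boundary conditions pointwise.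
   Formalization: The constant M_1 may depend on q_0 as well as on M, ψ and K; a bound independent of q_0 is false (heat equation, ψ=1, b=1, K=0, boundary values rising ever faster from 0 to M, with q_0 = sup|g|). *)

(* Defs.v *)
From HB Require Import structures.
From mathcomp Require Import all_boot all_order all_algebra.
From mathcomp Require Import all_classical all_reals all_analysis.

Set Implicit Arguments.
Unset Strict Implicit.
Unset Printing Implicit Defensive.

Import Order.TTheory GRing.Theory Num.Theory.
Import numFieldNormedType.Exports.

Local Open Scope classical_set_scope.
Local Open Scope ring_scope.

(* Derivative of f relative to A: only the values of f on A matter.  At an
   endpoint of an interval A it is the one-sided derivative, which [derive1]
   cannot express for a total function standing for a function on A. *)
Definition derivable_in (R : realType) (A : set R) (f : R -> R) (x : R) : Prop :=
  cvg ((f y - f x) / (y - x) @[y --> within A x^']).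

Definition derive_in (R : realType) (A : set R) (f : R -> R) (x : R) : R :=
  lim ((f y - f x) / (y - x) @[y --> within A x^']).

(* psi \in C^1([0, oo), [1, oo)), with psi extended arbitrarily to R. *)
Definition C1_ge1 (R : realType) (psi : R -> R) : Prop :=
  [/\ forall r, 0 <= r -> 1 <= psi r,
      forall r, 0 <= r -> derivable_in `[0, +oo[ psi r &
      {within `[0, +oo[, continuous (derive_in `[0, +oo[ psi)}].

Definition Omega (R : realType) (l tau : R) : set (R * R) :=
  `]0, tau[ `*` `]- l, l[.

Definition Omegabar (R : realType) (l tau : R) : set (R * R) :=
  `[0, tau] `*` `[- l, l].

Definition supnorm (R : realType) (D : set (R * R)) (v : R -> R -> R) : \bar R :=
  ereal_sup [set `|v z.1 z.2|%:E | z in D].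

(* Functions on subsets of (t, x)-space are total functions [u t x]; values
   off the closed domain play no role. *)
Definition dt (R : realType) (u : R -> R -> R) (t x : R) : R :=
  derive1 (fun s => u s x) t.

Definition dx (R : realType) (u : R -> R -> R) (t x : R) : R := derive1 (u t) x.

Definition dxx (R : realType) (u : R -> R -> R) (t x : R) : R := derive1 (dx u t) x.

(* u_x(t, x) for x = l or x = - l (one-sided). *)
Definition dx_bnd (R : realType) (l : R) (u : R -> R -> R) (t x : R) : R :=
  derive_in `[- l, l] (u t) x.

Record classical_regularity (R : realType) (l tau : R) (u : R -> R -> R) : Prop :=
  ClassicalRegularity {
    cr_cont : {within Omegabar l tau, continuous (fun z : R * R => u z.1 z.2)};
    cr_dt : forall t x, Omega l tau (t, x) -> derivable (fun s => u s x) t 1;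
    cr_dx : forall t x, Omega l tau (t, x) -> derivable (u t) x 1;
    cr_dxx : forall t x, Omega l tau (t, x) -> derivable (dx u t) x 1;
    cr_dt_cont :
      {within Omega l tau, continuous (fun z : R * R => dt u z.1 z.2)};
    cr_dxx_cont :
      {within Omega l tau, continuous (fun z : R * R => dxx u z.1 z.2)};
    cr_dt_bnd : forall t x, 0 < t < tau -> x = l \/ x = - l ->
      derivable (fun s => u s x) t 1;
    cr_dx_bnd : forall t x, 0 < t < tau -> x = l \/ x = - l ->
      derivable_in `[- l, l] (u t) x }.

(* The coefficients take (t, x, z, p); b and g are only used at x = l, - l. *)
Record classical_solution (R : realType) (l tau : R)
    (a f b g : R -> R -> R -> R -> R) (u : R -> R -> R) : Prop :=
  ClassicalSolution {
    cs_reg : classical_regularity l tau u;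
    cs_eq : forall t x, Omega l tau (t, x) ->
      dt u t x - a t x (u t x) (dx u t x) * dxx u t x
      = f t x (u t x) (dx u t x);
    cs_bc_right : forall t, 0 < t < tau ->
      dt u t l + b t l (u t l) (dx_bnd l u t l) * dx_bnd l u t l
      = g t l (u t l) (dx_bnd l u t l);
    cs_bc_left : forall t, 0 < t < tau ->
      dt u t (- l)
        - b t (- l) (u t (- l)) (dx_bnd l u t (- l)) * dx_bnd l u t (- l)
      = g t (- l) (u t (- l)) (dx_bnd l u t (- l)) }.

Definition continuous_coef (R : realType) (l T : R)
    (h : R -> R -> R -> R -> R) : Prop :=
  {within `[0, T] `*` `[- l, l] `*` [set: R] `*` [set: R],
    continuous (fun y : R * R * R * R => h y.1.1.1 y.1.1.2 y.1.2 y.2)}.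

Definition continuous_bnd_coef (R : realType) (l T : R)
    (h : R -> R -> R -> R -> R) : Prop :=
  forall x, x = l \/ x = - l ->
  {within `[0, T] `*` [set: R] `*` [set: R],
    continuous (fun y : R * R * R => h y.1.1 x y.1.2 y.2)}.

(* Main.v *)
(* Kruzhkov's method: compare u(t, x) - u(t, y) with h(x - y), where h is concave,
   h'' + psi(h') = 0, h(0) = 0, h' >= q0 and h(d) >= 2M; such an h exists on some
   [0, d] because of the integral condition, and q1 = h'(0) depends only on M, psi
   and q0.  At a positive maximum of u(t, x) - u(t, y) - h(x - y) - e t over
   0 <= x - y <= d, the conditions t = 0, x = y and x - y = d are excluded by the
   Lipschitz bound on u^0, by h(0) = 0 and by |u| <= M.  For x interior, u_x = h'
   and u_xx <= h'' = - psi(u_x), so the equation gives u_t(t, x) <= 0; for x = l,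
   u_x >= h' >= q0, and the dynamic boundary condition gives the same.  Likewise
   u_t(t, y) >= 0, which contradicts u_t(t, x) - u_t(t, y) >= e.  Hence
   u(t, x) - u(t, y) <= h(x - y) <= q1 (x - y), so u_x <= q1; the lower bound
   follows by applying this to - u. *)
Require Import Defs.
From HB Require Import structures.
From mathcomp Require Import all_boot all_order all_algebra.
From mathcomp Require Import all_classical all_reals all_analysis.
From mathcomp Require Import ring lra.

Set Implicit Arguments.
Unset Strict Implicit.
Unset Printing Implicit Defensive.

Import Order.TTheory GRing.Theory Num.Theory.
Import numFieldNormedType.Exports.

Local Open Scope classical_set_scope.
Local Open Scope ring_scope.

(** * One-variable calculus *)

Lemma derivable_in_cvg (R : realType) (A : set R) (f : R -> R) (x : R) :
  derivable_in A f x -> f y @[y --> within A (nbhs x)] --> f x.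
Proof.
move=> dfx.
have cf : f y @[y --> within A x^'] --> f x.
  have : (f y - f x) / (y - x) * (y - x) + f x @[y --> within A x^'] -->
      derive_in A f x * (x - x) + f x.
    apply: cvgD; last exact: cvg_cst.
    apply: cvgM; first exact: dfx.
    apply: cvgB; last exact: cvg_cst.
    do 2 apply: cvg_within_filter; exact: cvg_id.
  rewrite subrr mulr0 add0r; apply: cvg_trans.
  apply: near_eq_cvg; rewrite near_withinE /= near_withinE.
  by near=> y => yx _; rewrite divfK ?subrK// subr_eq0.
(* The limit over punctured neighbourhoods extends to [x] itself, since [f x] lies in every
   neighbourhood of [f x]. *)
move=> B Bfx.
have h : \forall y \near x, y != x -> A y -> B (f y) := cf B Bfx.
change (\forall y \near x, A y -> B (f y)).
apply: filterS h => y h; have [->//|/eqP yx] := pselect (y = x); last exact: h.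
by move=> _; exact: nbhs_singleton.
Unshelve. all: by end_near. Qed.

(** The integral from [a] is differentiated at a point interior to [[a, x + 1]], whence the strict
    inequality [a < x]. *)
Lemma primitive_exists (R : realType) (f : R -> R) (a : R) :
  continuous f ->
  exists F : R -> R, forall x, a < x -> is_derive x 1 F (f x).
Proof.
move=> cf; exists (fun x => \int[lebesgue_measure]_(t in `[a, x]) f t)%R => x ax.
have intf : lebesgue_measure.-integrable `[a, x + 1] (EFin \o f).
  apply: continuous_compact_integrable; first exact: segment_compact.
  exact: continuous_subspaceT.
have xx1 : x < x + 1 by rewrite ltrDl.
have [d e] := @continuous_FTC1_closed R f a x (x + 1) xx1 intf ax (cf x).
move: d e; set F := (fun x => _) => d e; apply: DeriveDef; first exact: d.
by rewrite -derive1E; exact: e.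
Qed.

(** Otherwise [F - F a] would stay below [L] on [[a, +oo[]; being monotone, [F] would converge at
    infinity, and the integral, equal to the limit minus [F a], would be at most [L]. *)
Lemma primitive_gt_integral (R : realType) (f F : R -> R) (a L : R) :
  (forall x, a <= x -> 0 <= f x) -> continuous f ->
  (forall x, a <= x -> is_derive x 1 F (f x)) ->
  (L%:E < \int[lebesgue_measure]_(x in `[a, +oo[) (f x)%:E)%E ->
  exists2 q, a < q & L < F q - F a.
Proof.
move=> f0 cf dF LI.
apply: contrapT => /forall2NP h.
have cF : {within `[a, +oo[, continuous F}.
  by apply: derivable_within_continuous => x; rewrite in_itv/= andbT => /dF.
have Fa : forall q, a < q -> F q - F a <= L.
  by move=> q aq; have [//|/negP] := h q; rewrite -leNgt.
have ndF x y : a <= x -> x <= y -> F x <= F y.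
  move=> ax xy; have [||c cxy e] := @MVT_segment R F f x y xy.
  - by move=> z; rewrite in_itv/= => /andP[xz _]; apply: dF; lra.
  - by move: cF; apply: continuous_subspaceW => z /=; rewrite !in_itv/=; lra.
  rewrite -subr_ge0 e mulr_ge0 ?subr_ge0// f0//.
  by move: cxy; rewrite in_itv/= => /andP[]; lra.
(* Freezing [F] to the left of [a] makes it monotone on the whole line, so that it tends to its
   supremum. *)
pose Fm x := F (Num.max a x).
have Fm_le x : Fm x <= F a + L.
  rewrite /Fm; have [xa|ax] := leP x a; last by have := Fa _ ax; lra.
  by have := Fa (a + 1); have := ndF a (a + 1); lra.
have Fm_cvg : Fm r @[r --> +oo] --> sup (range Fm).
  apply: nondecreasing_cvgr.
    by move=> x y xy; apply: ndF; [rewrite le_max lexx|rewrite ge_max !le_max lexx/= xy orbT].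
  by exists (F a + L) => _ [x _ <-].
have sup_le : sup (range Fm) <= F a + L.
  by apply: ge_sup; [exists (Fm 0), 0|move=> _ [x _ <-]].
move: LI; rewrite (@ge0_continuous_FTC2y R f F a (sup (range Fm)))//.
- by rewrite -EFinB lte_fin; lra.
- exact: continuous_subspaceT.
- apply: cvg_trans Fm_cvg; apply: near_eq_cvg.
  near=> x; rewrite /Fm max_r//; near: x; exact: nbhs_pinfty_ge.
- by move=> x ax; have [] := dF x (ltW ax).
- apply: cvg_at_right_filter; apply: differentiable_continuous.
  by apply/derivable1_diffP; have [] := dF a (lexx _).
- move=> x; rewrite in_itv/= andbT => ax; rewrite derive1E.
  by have [] := dF x (ltW ax).
Unshelve. all: by end_near. Qed.

(** If [c < 0], the continuous slope function of Caratheodory is negative near [x], so [f] is larger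
    just to the left. Only a one-sided maximum is assumed because a maximum in time may occur at the
    final time. *)
Lemma left_max_derive_ge0 (R : realType) (f : R -> R) (x c : R) :
  is_derive x 1 f c -> (\forall y \near x, y <= x -> f y <= f x) -> 0 <= c.
Proof.
move=> /is_derive1_caratheodory[g [fE cg gx]] xmax; rewrite leNgt.
apply/negP => c0.
have g0 : \forall y \near x, g y < 0.
  by apply: (cvgr_lt (g x) cg); rewrite gx.
have /nbhs_ballP[e /= e0 he] : \forall y \near x, g y < 0 /\ (y <= x -> f y <= f x).
  by near=> y; split; near: y.
have ball_y : ball x e (x - e / 2).
  by rewrite /ball/= opprB addrC subrK gtr0_norm; lra.
have [gy /(_ _)fy] := he _ ball_y.
have := fE (x - e / 2).
have : 0 < g (x - e / 2) * (x - e / 2 - x) by rewrite nmulr_rgt0//; lra.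
by have := fy; lra.
Unshelve. all: by end_near. Qed.

(* The first derivative of [f] vanishes at [x], so a positive second
   derivative would make [f] strictly increasing to the right of [x]. *)
Lemma max_derive2_le0 (R : realType) (f f' : R -> R) (x c : R) :
  (\forall y \near x, is_derive (y : R) 1 f (f' y)) -> is_derive x 1 f' c ->
  (\forall y \near x, f y <= f x) -> f' x = 0 /\ c <= 0.
Proof.
move=> df df' xmax.
have f'x : f' x = 0.
  have /nbhs_ballP[e /= e0 he] : \forall y \near x, is_derive (y : R) 1 f (f' y) /\ f y <= f x.
    by near=> y; split; near: y.
  have in_ball y : y \in `]x - e, x + e[ -> ball x e y.
    by rewrite in_itv/= => /andP[? ?]; rewrite /ball/= ltr_distl; lra.
  have fx0 : is_derive x 1 f 0.
    apply: (@derive1_at_max _ f (x - e) (x + e)).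
    - lra.
    - by move=> t /in_ball/he[[]].
    - by rewrite in_itv/=; lra.
    - by move=> t /in_ball/he[].
  have [_ <-] := nbhs_singleton df.
  by have [_] := fx0.
split=> //; rewrite leNgt; apply/negP => c0.
move: df' => /is_derive1_caratheodory[g [fE cg gx]].
have g0 : \forall y \near x, 0 < g y.
  by apply: (cvgr_gt (g x) cg); rewrite gx.
have /nbhs_ballP[e /= e0 he] : \forall y \near x,
    [/\ 0 < g y, is_derive (y : R) 1 f (f' y) & f y <= f x].
  by near=> y; split; near: y.
have hz z : x <= z <= x + e / 2 -> [/\ 0 < g z, is_derive z 1 f (f' z) & f z <= f x].
  by move=> /andP[? ?]; apply: he; rewrite /ball/= ltr_distl; lra.
have xy : x < x + e / 2 by lra.
have [||z] := @MVT R f f' x (x + e / 2) xy.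
- by move=> z; rewrite in_itv/= => zI; have [|//] := hz z; lra.
- by apply: derivable_within_continuous => z; rewrite in_itv/= => /hz[_ []].
rewrite in_itv/= => zI.
have [|gz _ _] := hz z; first lra.
have [|_ _ fe] := hz (x + e / 2); first lra.
have -> : f' z = g z * (z - x) by rewrite -fE f'x subr0.
have : 0 < g z * (z - x) * (x + e / 2 - x) by rewrite !mulr_gt0//; lra.
by lra.
Unshelve. all: by end_near. Qed.

(** * Derivatives relative to an interval *)

Lemma proper_within_dnbhs (R : realType) (A : set R) (x : R) :
  (forall e, 0 < e -> exists y, [/\ A y, y != x & `|x - y| < e]) ->
  ProperFilter (within A x^').
Proof.
move=> hA; apply: Build_ProperFilter => /nbhs_ballP[e /= e0 he].
by have [y [Ay yx xye]] := hA e e0; exact: (he y xye yx Ay).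
Qed.

(** The order of difference quotients passes to the limit. On the lateral boundary, with [g] built
    from the barrier, this gives [u_x >= h']. *)
Lemma derive_in_ge (R : realType) (A : set R) (f g : R -> R) (x c : R) :
  ProperFilter (within A x^') -> derivable_in A f x -> is_derive x 1 g c ->
  (\forall y \near x, A y -> y != x ->
    (g y - g x) / (y - x) <= (f y - f x) / (y - x)) ->
  c <= derive_in A f x.
Proof.
move=> FF dfx /is_derive1_caratheodory[k [gE ck <-]] gf.
have h : (f y - f x) / (y - x) @[y --> within A x^'] --> derive_in A f x := dfx.
have ckA : k y @[y --> within A x^'] --> k x.
  by do 2 apply: cvg_within_filter; exact: ck.
apply: (ler_cvg_to ckA h).
rewrite near_withinE near_withinE /=; apply: filterS gf => y gf yx Ay.
by apply: le_trans (gf Ay yx); rewrite gE mulfK// subr_eq0.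
Qed.

Lemma proper_within_itv_right (R : realType) (a b : R) :
  a < b -> ProperFilter (within `[a, b] b^').
Proof.
move=> ab; apply: proper_within_dnbhs => e e0.
have [ae|ea] := leP (b - e / 2) a.
  exists a; split; [by rewrite /= in_itv/= lexx ltW|by rewrite lt_eqF|].
  by rewrite ltr_distl; lra.
exists (b - e / 2); split; [by rewrite /= in_itv/=; lra|by rewrite lt_eqF; lra|].
by rewrite ltr_distl; lra.
Qed.

Lemma proper_within_itv_left (R : realType) (a b : R) :
  a < b -> ProperFilter (within `[a, b] a^').
Proof.
move=> ab; apply: proper_within_dnbhs => e e0.
have [be|eb] := leP b (a + e / 2).
  exists b; split; [by rewrite /= in_itv/= lexx ltW|by rewrite gt_eqF|].
  by rewrite ltr_distl; lra.
exists (a + e / 2); split; [by rewrite /= in_itv/=; lra|by rewrite gt_eqF; lra|].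
by rewrite ltr_distl; lra.
Qed.

(** * The barrier *)

(** The values of [psi] at negative arguments are arbitrary. Its even extension is continuous on the
    whole line, so two-sided calculus is possible around [q0] even if [q0 = 0]. *)
Lemma C1_ge1_continuous_abs (R : realType) (psi : R -> R) :
  C1_ge1 psi -> continuous (fun r : R => psi `|r|).
Proof.
move=> [_ dpsi _] x.
have := @derivable_in_cvg _ _ _ _ (dpsi `|x| (normr_ge0 x)).
move=> h B /h{}h.
have {}h : \forall y \near `|x|, y \in `[0, +oo[ -> B (psi y) := h.
have : \forall y \near x, `|y| \in `[0, +oo[ -> B (psi `|y|).
  exact: (@norm_continuous R R^o x _ h).
by apply: filterS => y; apply; rewrite in_itv/= normr_ge0.
Qed.

(** The derivatives are two-sided even at [s = 0] and [s = d]; in particular [h] is continuous there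
    in the full sense. *)
Definition barrier (R : realType) (psi : R -> R) (q0 d : R) (h h' : R -> R) :=
  forall s, 0 <= s <= d -> [/\ is_derive s 1 h (h' s),
    is_derive s 1 h' (- psi (h' s)) & q0 <= h' s].

(* [h] solves [h'' + psi(h') = 0]; it is obtained in parametric form, with
   [q = h'] as the parameter: [s = \int_q^q1 dr / psi r] and
   [h = \int_q^q1 r dr / psi r]. *)
Lemma barrier_exists (R : realType) (psi : R -> R) (q0 L : R) :
  0 <= q0 -> C1_ge1 psi ->
  (L%:E < \int[lebesgue_measure]_(r in `[q0, +oo[) (r / psi r)%:E)%E ->
  exists q1 d : R, exists h h' : R -> R,
  [/\ 0 < d, h 0 = 0, L <= h d, barrier psi q0 d h h' &
   forall s, 0 <= s <= d -> h' s <= q1].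
Proof.
move=> q0_ge0 psiC1 LI.
have cPsi := C1_ge1_continuous_abs psiC1.
have [psi_ge1 _ _] := psiC1.
have Psi_gt0 (r : R) : 0 < psi `|r| by rewrite (lt_le_trans _ (psi_ge1 _ _)).
have Psi_neq0 (r : R) : psi `|r| != 0 by rewrite gt_eqF.
have cinv : continuous (fun r : R => (psi `|r|)^-1).
  by move=> x; apply: cvgV; [exact: Psi_neq0|exact: cPsi].
have cid : continuous (fun r : R => r / psi `|r|).
  by move=> x; apply: cvgM; [exact: cvg_id|exact: cinv].
(* The base point [-1] puts all of [[q0, q1]], including a possible [q0 = 0], in the interior of the
   parameter range. *)
have [F dF] := primitive_exists (-1) cinv.
have [G dG] := primitive_exists (-1) cid.
have q0N1 : -1 < q0 by lra.
(* With [d = S q0], the difference [G q1 - G q0] will be the value [h d]. *)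
have [q1 q01 LG] : exists2 q, q0 < q & L < G q - G q0.
  apply: primitive_gt_integral cid _ _.
  - by move=> x qx; apply: divr_ge0; [exact: le_trans qx|exact: ltW].
  - by move=> x qx; apply: dG; lra.
  - apply: (lt_le_trans LI); rewrite le_eqVlt; apply/orP; left; apply/eqP.
    apply: eq_integral => r; rewrite inE/= in_itv/= andbT => qr.
    by rewrite ger0_norm// (le_trans q0_ge0).
have dFq (x : R) : -1 < x -> derivable F x 1 by move=> /dF [].
have cF (x : R) : -1 < x -> {for x, continuous F}.
  by move=> /dFq /derivable1_diffP /differentiable_continuous.
have wF (a b : R) : -1 < a -> {within `[a, b], continuous F}.
  move=> a1; apply: derivable_within_continuous => x.
  by rewrite in_itv/= => /andP[ax _]; apply: dFq; lra.
have incF (x y : R) : -1 < x -> x < y -> F x < F y.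
  move=> x1 xy; have [||c cxy e] := @MVT R F (fun r : R => (psi `|r|)^-1) x y xy.
  - by move=> z; rewrite in_itv/= => /andP[xz _]; apply: dF; lra.
  - exact: wF.
  by rewrite -subr_gt0 e mulr_gt0 ?invr_gt0// subr_gt0.
have injF (x y : R) : -1 < x -> -1 < y -> F x = F y -> x = y.
  move=> x1 y1 e; have [xy|xy|//] := ltgtP x y.
    by have := incF _ _ x1 xy; rewrite e ltxx.
  by have := incF _ _ y1 xy; rewrite e ltxx.
pose S (q : R) : R := F q1 - F q.
(* [Q] inverts [S] on [q > -1], where [S] is injective; [0] is the default off the image of [S]. *)
pose Q (s : R) : R := xget 0 [set q | -1 < q /\ S q = s].
have SK (q : R) : -1 < q -> Q (S q) = q.
  move=> qN1; rewrite /Q; case: xgetP => [p _ [p1 e]|/(_ q)]; last by case.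
  by apply: injF => //; move: e; rewrite /S; lra.
have dS (q : R) : -1 < q -> is_derive q 1 S (- (psi `|q|)^-1).
  move=> q_gt; rewrite -sub0r; apply: is_deriveB; exact: dF.
have dQ (q : R) : -1 < q -> is_derive (S q) 1 Q (- psi `|q|).
  move=> q_gt; have := dS q q_gt => dSq.
  have nq : \forall x \near q, -1 < x by exact: lt_nbhsr.
  rewrite -[X in is_derive _ _ _ X]invrK invrN; apply: is_derive_inverse.
  - by apply: filterS nq => x /SK.
  - apply: filterS nq => x x1; apply: cvgB; [exact: cvg_cst|exact: cF].
  - by rewrite oppr_eq0 invr_eq0.
(* The chain rule gives [- (q / psi) * (- psi) = q], so the derivative of [h] is [Q] itself, and
   [dQ] is the equation for [h'']. *)
have dh (q : R) : -1 < q -> is_derive (S q) 1 (fun s => G q1 - G (Q s)) q.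
  move=> q_gt; have dQq := dQ q q_gt.
  have dGq : is_derive (Q (S q)) 1 G (q / psi `|q|) by rewrite SK//; exact: dG.
  have := is_deriveB (is_derive_cst (G q1) (S q) 1) (is_derive1_comp dGq dQq).
  move=> H; apply: is_derive_eq H _.
  by rewrite sub0r mulrN opprK divfK.
(* Each [s] in [[0, d]] has its parameter in [[q0, q1]]; this yields both bounds on [h']. *)
have Ssurj s : 0 <= s <= S q0 ->
    exists q, [/\ -1 < q, q0 <= q, q <= q1 & S q = s].
  move=> /andP[s0 sS].
  have [q + Sq] : exists2 q, q \in `[q0, q1] & S q = s.
    apply: IVT; first exact: ltW.
      by apply: within_continuousB; [move=> x; exact: cvg_cst|exact: wF].
    by rewrite /S subrr ge_min le_max s0 sS orbT.
  by rewrite in_itv/= => /andP[q0q qq1]; exists q; split => //; lra.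
exists q1, (S q0), (fun s => G q1 - G (Q s)), Q; split.
- by rewrite subr_gt0; exact: incF.
- have q1N1 : -1 < q1 by lra.
  have S1 : S q1 = 0 by exact: subrr.
  by rewrite -{1}S1 SK// subrr.
- by rewrite SK// ltW.
- move=> s /Ssurj[q [qN1 q0q _ <-]].
  rewrite SK//; split => //; first exact: dh.
  by have := dQ q qN1; rewrite ger0_norm//; lra.
- by move=> s /Ssurj[q [qN1 _ qq1 <-]]; rewrite SK.
Qed.

(** * Comparison with the barrier *)

(* The only trace of the equation, the growth condition on [f] and the boundary
   conditions that the comparison argument uses. *)
Record slope_controlled (R : realType) (l tau q0 : R) (psi : R -> R)
    (u : R -> R -> R) : Prop := SlopeControlled {
  sc_reg : classical_regularity l tau u;
  sc_le0 : forall t x, Omega l tau (t, x) -> q0 <= dx u t x ->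
    dxx u t x <= - psi (dx u t x) -> dt u t x <= 0;
  sc_ge0 : forall t x, Omega l tau (t, x) -> q0 <= dx u t x ->
    psi (dx u t x) <= dxx u t x -> 0 <= dt u t x;
  sc_right : forall t, 0 < t < tau -> q0 <= dx_bnd l u t l -> dt u t l <= 0;
  sc_left : forall t, 0 < t < tau -> q0 <= dx_bnd l u t (- l) ->
    0 <= dt u t (- l) }.

Lemma regular_derivable_t (R : realType) (l tau : R) (u : R -> R -> R) (t x : R) :
  classical_regularity l tau u -> 0 < t < tau -> - l <= x <= l ->
  derivable (fun s => u s x) t 1.
Proof.
move=> reg tI /andP[]; rewrite le_eqVlt => /predU1P[<- _|lx].
  by apply: (cr_dt_bnd reg) => //; right.
rewrite le_eqVlt => /predU1P[->|xl].
  by apply: (cr_dt_bnd reg) => //; left.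
by apply: (cr_dt reg); split; rewrite /= in_itv//= lx.
Qed.

Lemma is_derive_affine (R : realType) (f : R -> R) (a b x c : R) :
  is_derive (a * x + b) 1 f c -> is_derive x 1 (fun z => f (a * z + b)) (c * a).
Proof.
move=> df.
have da : is_derive x 1 (fun z : R => a * z + b) a.
  have : is_derive x 1 (a *: (@id R) + cst b) (a *: 1 + 0).
    exact: is_deriveD.
  by rewrite addr0 /GRing.scale/= mulr1.
exact: is_derive1_comp.
Qed.

(** With [y] fixed, [z] to [u t z - h (z - y)] is maximal at [x]. For [x < l] the first and second
    order conditions feed [sc_le0]; for [x = l] only points to the left compete, which suffices for
    [sc_right]. *)
Lemma dt_le0_at_max (R : realType) (l tau q0 d : R) (psi h h' : R -> R)
    (u : R -> R -> R) (t x y : R) :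
  slope_controlled l tau q0 psi u -> barrier psi q0 d h h' -> 0 < l ->
  0 < t < tau -> - l <= y -> y < x -> x <= l -> x - y < d ->
  (forall z, y <= z <= l -> z - y <= d ->
     u t z - h (z - y) <= u t x - h (x - y)) ->
  dt u t x <= 0.
Proof.
move=> [reg le0 _ right0 _] bar l0 tI ly yx xl xyd xmax.
have dh z : y <= z -> z - y <= d -> is_derive (1 * z + (- y)) 1 h (h' (z - y)).
  by move=> yz zd; rewrite mul1r; have [|//] := bar (z - y); lra.
have dhz z : y <= z -> z - y <= d -> is_derive z 1 (fun z => h (z - y)) (h' (z - y)).
  move=> yz zd; have := is_derive_affine (dh z yz zd); rewrite mulr1.
  by under eq_fun do rewrite mul1r.
move: xl; rewrite le_eqVlt => /predU1P[xl|xl].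
  subst x; apply: right0 => //.
  have [|_ _ q0h] := bar (l - y); first lra.
  apply: (le_trans q0h); apply: (@derive_in_ge _ _ _ (fun z => h (z - y))).
  - by apply: proper_within_itv_right; lra.
  - by apply: (cr_dx_bnd reg) => //; left.
  - by apply: dhz; lra.
  have : \forall z \near l, y < z by exact: lt_nbhsr.
  apply: filterS => z yz; rewrite /= in_itv/= => /andP[lz zl] zNl.
  have zl' : z < l by rewrite lt_neqAle zNl.
  (* Here [z - l < 0], so dividing turns the maximum inequality into a lower bound on the quotient
     of [u]. *)
  rewrite ler_ndivlMr ?subr_lt0// divfK ?subr_eq0//.
  by have := xmax z; lra.
have Otx : Omega l tau (t, x).
  by split; rewrite /= in_itv/=; lra.
(* The strict inequalities [y < x < l] and [x - y < d] leave room on both sides of [x] within the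
   range where [xmax] is available. *)
have near_x : \forall z \near x, z \in `]y, Num.min l (y + d)[.
  by apply: near_in_itvoo; rewrite in_itv/= lt_min; lra.
have zP z : z \in `]y, Num.min l (y + d)[ -> [/\ y < z, z < l & z < y + d].
  by rewrite in_itv/= lt_min => /and3P[].
have [dx0 dxx0] : dx u t x - h' (x - y) = 0 /\ dxx u t x + psi (h' (x - y)) <= 0.
  apply: (@max_derive2_le0 _ (fun z => u t z - h (z - y))
    (fun z => dx u t z - h' (z - y)) x).
  - apply: filterS near_x => z /zP[yz zl zd].
    apply: is_deriveB; last by apply: dhz; lra.
    apply: DeriveDef; last by rewrite /dx derive1E.
    by apply: (cr_dx reg); split; rewrite /= in_itv/=; lra.
  - rewrite -[psi _]opprK; apply: is_deriveB.
      apply: DeriveDef; last by rewrite /dxx derive1E.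
      by apply: (cr_dxx reg).
    have [|_ dh' _] := bar (x - y); first lra.
    have {}dh' : is_derive (1 * x - y) 1 h' (- psi (h' (x - y))) by rewrite mul1r.
    have := is_derive_affine dh'; rewrite mulr1.
    by under eq_fun do rewrite mul1r.
  - apply: filterS near_x => z /zP[yz zl zd].
    by apply: xmax; lra.
have dxE : dx u t x = h' (x - y) by lra.
apply: le0 => //; rewrite dxE; last lra.
by have [|//] := bar (x - y); lra.
Qed.

(** With [x] fixed, [z] to [- u t z - h (x - z)] is maximal at [y]. Differentiating [h (x - z)]
    twice in [z] gives [h''] again, so here [u_xx >= psi (u_x)]; at [y = - l] the competitors lie to
    the right. *)
Lemma dt_ge0_at_max (R : realType) (l tau q0 d : R) (psi h h' : R -> R)
    (u : R -> R -> R) (t x y : R) :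
  slope_controlled l tau q0 psi u -> barrier psi q0 d h h' -> 0 < l ->
  0 < t < tau -> - l <= y -> y < x -> x <= l -> x - y < d ->
  (forall z, - l <= z <= x -> x - z <= d ->
     u t y + h (x - y) <= u t z + h (x - z)) ->
  0 <= dt u t y.
Proof.
move=> [reg _ ge0 _ left0] bar l0 tI ly yx xl xyd ymin.
have dhz z : z <= x -> x - z <= d -> is_derive z 1 (fun z => h (x - z)) (- h' (x - z)).
  move=> zx zd; have dh : is_derive (-1 * z + x) 1 h (h' (x - z)).
    by rewrite mulN1r addrC; have [|//] := bar (x - z); lra.
  have := is_derive_affine dh; rewrite mulrN1.
  by under eq_fun do rewrite mulN1r addrC.
have dNhz z : z <= x -> x - z <= d -> is_derive z 1 (fun z => - h (x - z)) (h' (x - z)).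
  by move=> zx zd; rewrite -[h' _]opprK; apply: is_deriveN; exact: dhz.
move: ly; rewrite le_eqVlt => /predU1P[ly|ly].
  subst y; apply: left0 => //.
  have [|_ _ q0h] := bar (x - - l); first lra.
  apply: (le_trans q0h); apply: (@derive_in_ge _ _ _ (fun z => - h (x - z))).
  - by apply: proper_within_itv_left; lra.
  - by apply: (cr_dx_bnd reg) => //; right.
  - by apply: dNhz; lra.
  have : \forall z \near (- l), z < x by exact: lt_nbhsl.
  apply: filterS => z zx; rewrite /= in_itv/= => /andP[lz zl] zNl.
  have lz' : - l < z by rewrite lt_neqAle eq_sym zNl.
  rewrite ler_pdivlMr ?subr_gt0// divfK ?subr_eq0//.
  by have := ymin z; lra.
have Oty : Omega l tau (t, y).
  by split; rewrite /= in_itv/=; lra.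
have near_y : \forall z \near y, z \in `]Num.max (- l) (x - d), x[.
  by apply: near_in_itvoo; rewrite in_itv/= gt_max; lra.
have zP z : z \in `]Num.max (- l) (x - d), x[ -> [/\ - l < z, x - d < z & z < x].
  by rewrite in_itv/= gt_max => /andP[/andP[]].
have [dx1 dxx1] : - dx u t y - - h' (x - y) = 0 /\ - dxx u t y + psi (h' (x - y)) <= 0.
  apply: (@max_derive2_le0 _ (fun z => - u t z - h (x - z))
    (fun z => - dx u t z - - h' (x - z)) y).
  - apply: filterS near_y => z /zP[lz zd zx].
    apply: is_deriveB; last by apply: dhz; lra.
    apply: is_deriveN; apply: DeriveDef; last by rewrite /dx derive1E.
    by apply: (cr_dx reg); split; rewrite /= in_itv/=; lra.
  - rewrite -[psi _]opprK; apply: is_deriveB.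
      apply: is_deriveN; apply: DeriveDef; last by rewrite /dxx derive1E.
      by apply: (cr_dxx reg).
    have [|_ dh' _] := bar (x - y); first lra.
    have {}dh' : is_derive (-1 * y + x) 1 h' (- psi (h' (x - y))) by rewrite mulN1r addrC.
    have := is_derive_affine dh'; rewrite mulrN1 opprK => dh''.
    apply: is_deriveN; move: dh''.
    by under eq_fun do rewrite mulN1r addrC.
  - apply: filterS near_y => z /zP[lz zd zx].
    by have := ymin z; lra.
have dxE : dx u t y = h' (x - y) by lra.
apply: ge0 => //; rewrite dxE; last lra.
by have [|//] := bar (x - y); lra.
Qed.

(** A point [p] stands for [(t, (x, y))]. The time cut [t0], later taken below [tau], keeps a
    maximum with positive time inside the range where the equation holds. *)
Lemma doubled_max (R : realType) (l tau t0 d e : R) (h : R -> R) (u : R -> R -> R)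
    (w := fun p : R * (R * R) =>
       u p.1 p.2.1 - u p.1 p.2.2 - h (p.2.1 - p.2.2) - e * p.1)
    (D := [set p : R * (R * R) | [/\ 0 <= p.1 <= t0, - l <= p.2.1 <= l,
       - l <= p.2.2 <= l & 0 <= p.2.1 - p.2.2 <= d]]) :
  t0 <= tau -> D !=set0 -> {within Omegabar l tau, continuous (fun z => u z.1 z.2)} ->
  (forall s, 0 <= s <= d -> {for s, continuous h}) ->
  exists2 p, D p & forall q, D q -> w q <= w p.
Proof.
move=> t0tau D0 cu ch.
have cfst (p : R * (R * R)) : q.1 @[q --> p] --> p.1 by exact: cvg_fst.
have cx (p : R * (R * R)) : q.2.1 @[q --> p] --> p.2.1.
  by apply: cvg_comp; [exact: cvg_snd|exact: cvg_fst].
have cy (p : R * (R * R)) : q.2.2 @[q --> p] --> p.2.2.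
  by apply: cvg_comp; [exact: cvg_snd|exact: cvg_snd].
have cs (p : R * (R * R)) : (q.2.1 - q.2.2) @[q --> p] --> p.2.1 - p.2.2.
  by apply: cvgB; [exact: cx|exact: cy].
have cD : compact D.
  have -> : D = (`[0, t0] `*` (`[- l, l] `*` `[- l, l])) `&`
      (fun p : R * (R * R) => p.2.1 - p.2.2) @^-1` `[0, d].
    by rewrite predeqE => -[t [x y]]; split; rewrite /D/= !in_itv/=;
      [case=> ? ? ? ?|case=> -[? [? ?]] ?].
  apply: compact_closedI.
    by do 2 (apply: compact_setX; first exact: segment_compact); exact: segment_compact.
  by apply: preimage_closed; [move=> p _; exact: cs|exact: interval_closed].
(* Taking [g] to be [fst] or [snd] treats [u t x] and [u t y] at once. *)
have cu' (g : R * R -> R) (p : R * (R * R)) :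
    (forall q : R * R, - l <= q.1 <= l -> - l <= q.2 <= l -> - l <= g q <= l) ->
    continuous g -> D p ->
    u q.1 (g q.2) @[q --> within D (nbhs p)] --> u p.1 (g p.2).
  move=> gI cg Dp.
  have Dg q : D q -> Omegabar l tau (q.1, g q.2).
    by case=> ? ? ? _; split; rewrite /= in_itv/=; [lra|exact: gI].
  have /subspace_continuousP/(_ (p.1, g p.2) (Dg _ Dp)) := cu.
  move=> h1 B /h1 {}h1.
  have {}h1 : \forall z \near (p.1, g p.2), Omegabar l tau z -> B (u z.1 z.2) := h1.
  have cgp : (q.1, g q.2) @[q --> p] --> (p.1, g p.2).
    apply: (@cvg_pair _ _ _ _ (nbhs p.1) (nbhs (g p.2)) _ _ _ fst (g \o snd)).
      exact: cfst.
    by apply: cvg_comp; [exact: cvg_snd|exact: cg].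
  have : \forall q \near p, Omegabar l tau (q.1, g q.2) -> B (u q.1 (g q.2)).
    exact: cgp h1.
  move=> hp; change (\forall q \near p, D q -> B (u q.1 (g q.2))).
  by apply: filterS hp => q hq Dq; apply: hq; exact: Dg.
have cw : {within D, continuous w}.
  apply/subspace_continuousP => p Dp.
  apply: cvgB; last first.
    by apply: cvg_within_filter; apply: cvgMr; exact: cfst.
  apply: cvgB; last first.
    apply: cvg_within_filter; apply: cvg_comp; first exact: cs.
    by apply: ch; case: Dp.
  apply: cvgB.
    by apply: (cu' fst) => //; move=> q; exact: cvg_fst.
  by apply: (cu' snd) => //; move=> q; exact: cvg_snd.
have [p pD pmax] := compact_EVT_max D0 cD cw.
exists p; first by rewrite inE in pD.
by move=> q Dq; apply: pmax; rewrite inE.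
Qed.

Lemma slope_controlled_le_barrier (R : realType) (l tau q0 d : R)
    (psi h h' : R -> R) (u : R -> R -> R) :
  slope_controlled l tau q0 psi u -> barrier psi q0 d h h' -> 0 < l ->
  h 0 = 0 ->
  (forall x y, - l <= y -> y <= x -> x <= l -> x - y <= d ->
     u 0 x - u 0 y <= h (x - y)) ->
  (forall t x y, 0 < t < tau -> - l <= x <= l -> - l <= y <= l ->
     u t x - u t y <= h d) ->
  forall t x y, 0 < t < tau -> - l <= y -> y <= x -> x <= l -> x - y <= d ->
    u t x - u t y <= h (x - y).
Proof.
move=> sc bar l0 h0 init osc t x y /andP[t0 ttau] ly yx xl xyd.
rewrite leNgt; apply/negP => lt.
(* With this [e] the penalty [e * t] uses up half of the excess over the barrier, so the penalized
   function is still positive at [(t, x, y)]. *)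
pose e := (u t x - u t y - h (x - y)) / (2 * t).
have e0 : 0 < e by rewrite divr_gt0//; lra.
have et : e * t = (u t x - u t y - h (x - y)) / 2.
  by rewrite /e; field; rewrite gt_eqF.
have [||||[s [x' y']] /= [sI xI yI xyI] pmax] :=
  @doubled_max R l tau t d e h u.
- exact: ltW.
- by exists (t, (x, y)); split => /=; lra.
- exact: (cr_cont (sc_reg sc)).
- move=> z zI; apply: differentiable_continuous; apply/derivable1_diffP.
  by have [[]] := bar z zI.
have wpos : 0 < u s x' - u s y' - h (x' - y') - e * s.
  have := pmax (t, (x, y)); rewrite /= et => /(_ _)H.
  have {}H := H ltac:(split; lra).
  lra.
have es : 0 <= e * s by apply: mulr_ge0; lra.
(* Positivity of the maximum excludes in turn [s = 0] by [init], [x' = y'] by [h0], and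
   [x' - y' = d] by [osc]. *)
have [s0|s0] := eqVneq s 0.
  by subst s; have := init x' y'; lra.
have {}s0 : 0 < s by lra.
have sI' : 0 < s < tau by lra.
have [xy'|xy'] := eqVneq x' y'.
  by move: wpos; rewrite xy' !subrr h0; lra.
have yx' : y' < x' by lra.
have xyd' : x' - y' < d.
  rewrite lt_neqAle (andP xyI).2 andbT; apply/eqP => E.
  by have := osc s x' y' sI' xI yI; move: wpos; rewrite E; lra.
have dtx : dt u s x' <= 0.
  apply: (dt_le0_at_max sc bar l0 sI' _ yx' _ xyd'); try lra.
  move=> z zI zd; have := pmax (s, (z, y')); rewrite /= => /(_ _)H.
  have {}H := H ltac:(split; lra).
  lra.
have dty : 0 <= dt u s y'.
  apply: (dt_ge0_at_max sc bar l0 sI' _ yx' _ xyd'); try lra.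
  move=> z zI zd; have := pmax (s, (x', z)); rewrite /= => /(_ _)H.
  have {}H := H ltac:(split; lra).
  lra.
have dtE z : - l <= z <= l -> is_derive s 1 (fun r => u r z) (dt u s z).
  move=> zI; apply: DeriveDef; first exact: regular_derivable_t (sc_reg sc) _ _.
  by rewrite /dt derive1E.
have de : is_derive s 1 (fun r : R => e * r + 0) e.
  by have := @is_derive_affine R id e 0 s 1 _; rewrite mul1r; apply.
have dw := is_deriveB (is_deriveB (dtE x' xI) (dtE y' yI)) de.
(* The maximum runs over times up to [t] and [s] may equal [t], so only earlier times are compared.
   The signs [dtx] and [dty] then contradict [e > 0]. *)
have : 0 <= dt u s x' - dt u s y' - e.
  apply: left_max_derive_ge0 dw _.
  have : \forall r \near s, 0 < r by exact: lt_nbhsr.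
  apply: filterS => r r0 rs.
  have := pmax (r, (x', y')); rewrite /= => /(_ _)H.
  have {}H := H ltac:(split; lra).
  change (u r x' - u r y' - (e * r + 0) <= u s x' - u s y' - (e * s + 0)).
  by lra.
by lra.
Qed.

(** * Classical solutions *)

(** The supremum sees only the open rectangle, but the boundary conditions involve [u] at [l] and
    [- l]. Those values are limits of interior ones, by continuity of [u t] relative to
    [[- l, l]]. *)
Lemma sup_bound_closure (R : realType) (l tau M : R) (u : R -> R -> R) :
  0 < l -> classical_regularity l tau u ->
  (supnorm (Omega l tau) u <= M%:E)%E ->
  forall t x, 0 < t < tau -> - l <= x <= l -> - M <= u t x <= M.
Proof.
move=> l0 reg uM t x tI xI; rewrite -ler_norml.
have inner y : - l < y < l -> `|u t y| <= M.
  move=> yI; rewrite -lee_fin; apply: le_trans uM.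
  by apply: ereal_sup_ubound; exists (t, y) => //; split; rewrite /= in_itv.
have bnd : (x = l \/ x = - l) -> ProperFilter (within `[- l, l] x^') -> `|u t x| <= M.
  move=> xl FF.
  have cu : `|u t y| @[y --> within `[- l, l] x^'] --> `|u t x|.
    apply: cvg_norm.
    have := derivable_in_cvg (cr_dx_bnd reg tI xl); apply: cvg_trans.
    apply: cvg_app => B /= h.
    change (\forall y \near x, `[- l, l]%classic y -> B y) in h.
    change (\forall y \near x, y != x -> `[- l, l]%classic y -> B y).
    by apply: filterS h => y hy _.
  apply: (cvgr_to_le cu); rewrite near_withinE near_withinE /=.
  (* Besides [y != x], the opposite endpoint has to be avoided for [y] to be interior. *)
  have : \forall y \near x, y != - x.
    case: xl => ->.
      have : \forall y \near l, - l < y by apply: lt_nbhsr; lra.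
      by apply: filterS => y ly; rewrite gt_eqF.
    have : \forall y \near (- l), y < l by apply: lt_nbhsl; lra.
    by apply: filterS => y ly; rewrite opprK lt_eqF.
  apply: filterS => y yNx yx; rewrite /= in_itv/= => /andP[ly yl].
  apply: inner; rewrite !lt_neqAle ly yl !andbT.
  by case: xl yNx yx => ->; rewrite ?opprK => ? ?; apply/andP; split => //; rewrite eq_sym.
have [xl|xl] := eqVneq x l.
  by apply: bnd; [left|rewrite xl; apply: proper_within_itv_right; lra].
have [xNl|xNl] := eqVneq x (- l).
  by apply: bnd; [right|rewrite xNl; apply: proper_within_itv_left; lra].
by apply: inner; rewrite !lt_neqAle xl eq_sym xNl.
Qed.

(** Since [u_x >= q0 >= 0], the absolute value in [psi] disappears and [u_t = a u_xx + f] lies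
    between [a (u_xx - psi (u_x))] and [a (u_xx + psi (u_x))]. On the boundary, [gb] is applied with
    [p = u_x]. *)
Lemma slope_controlled_solution (R : realType) (l tau q0 : R) (psi : R -> R)
    (a f b g : R -> R -> R -> R -> R) (u : R -> R -> R) :
  0 <= q0 -> classical_solution l tau a f b g u ->
  (forall t x, Omega l tau (t, x) -> 0 <= a t x (u t x) (dx u t x)) ->
  (forall t x, Omega l tau (t, x) ->
    `|f t x (u t x) (dx u t x)| <= a t x (u t x) (dx u t x) * psi `|dx u t x|) ->
  (forall t p, 0 < t < tau -> q0 <= p ->
    g t l (u t l) p <= b t l (u t l) p * p /\
    - g t (- l) (u t (- l)) p <= b t (- l) (u t (- l)) p * p) ->
  slope_controlled l tau q0 psi u.
Proof.
move=> q0_ge0 [reg eq bcr bcl] a0 fa gb; split.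
- exact: reg.
- move=> t x Otx q0p dxxp.
  have := fa _ _ Otx; have := eq _ _ Otx; have := ler_wpM2l (a0 _ _ Otx) dxxp.
  rewrite (ger0_norm (le_trans q0_ge0 q0p)) ler_norml mulrN.
  by move=> ? ? /andP[]; lra.
- move=> t x Otx q0p dxxp.
  have := fa _ _ Otx; have := eq _ _ Otx; have := ler_wpM2l (a0 _ _ Otx) dxxp.
  rewrite (ger0_norm (le_trans q0_ge0 q0p)) ler_norml.
  by move=> ? ? /andP[]; lra.
- by move=> t tI q0p; have := bcr _ tI; have [] := gb _ _ tI q0p; lra.
- by move=> t tI q0p; have := bcl _ tI; have [] := gb _ _ tI q0p; lra.
Qed.

(** * The reflection of [u] to [- u] *)

Lemma derive_in_opp (R : realType) (A : set R) (f : R -> R) (x : R) :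
  ProperFilter (within A x^') -> derivable_in A f x ->
  derivable_in A (fun y => - f y) x /\
  derive_in A (fun y => - f y) x = - derive_in A f x.
Proof.
move=> FF df.
have h : (f y - f x) / (y - x) @[y --> within A x^'] --> derive_in A f x := df.
have hN : (- f y - - f x) / (y - x) @[y --> within A x^'] --> - derive_in A f x.
  have E : (fun y => (- f y - - f x) / (y - x)) = (fun y => - ((f y - f x) / (y - x))).
    by apply/funext => y; rewrite -opprD mulNr.
  by rewrite E; exact: cvgN.
by split; [apply/cvg_ex; eexists; exact: hN|exact: cvg_lim hN].
Qed.

Lemma derive1_opp (R : realType) (f : R -> R) (x : R) :
  derivable f x 1 -> derive1 (fun y => - f y) x = - derive1 f x.
Proof. by move=> df; rewrite !derive1E; exact: deriveN. Qed.

(** This reduces the lower bound on [u_x] to the upper one. All derivatives change sign, hence so do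
    [f] and [g], whereas [a] and [b] only have their arguments [z] and [p] reflected. *)
Lemma classical_solution_opp (R : realType) (l tau : R)
    (a f b g : R -> R -> R -> R -> R) (u : R -> R -> R) : 0 < l ->
  classical_solution l tau a f b g u ->
  classical_solution l tau
    (fun t x z p => a t x (- z) (- p)) (fun t x z p => - f t x (- z) (- p))
    (fun t x z p => b t x (- z) (- p)) (fun t x z p => - g t x (- z) (- p))
    (fun t x => - u t x).
Proof.
move=> l0 [reg eq bcr bcl].
set v := fun t x => - u t x.
have dtv t x : 0 < t < tau -> - l <= x <= l -> dt v t x = - dt u t x.
  by move=> tI xI; apply: derive1_opp; exact: regular_derivable_t reg _ _.
have dxv t x : Omega l tau (t, x) -> dx v t x = - dx u t x.
  by move=> Otx; apply: derive1_opp; exact: (cr_dx reg).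
(* The second derivative needs this identity on a neighbourhood, not just at [x]. *)
have dxv_near t x : Omega l tau (t, x) -> \forall y \near x, - dx u t y = dx v t y.
  move=> [/= tI xI]; have := near_in_itvoo xI; apply: filterS => y yI.
  by rewrite dxv.
have dxxv t x : Omega l tau (t, x) ->
    derivable (dx v t) x 1 /\ dxx v t x = - dxx u t x.
  move=> Otx; have ddx := cr_dxx reg Otx; split.
    by apply: near_eq_derivable (dxv_near _ _ Otx) _; exact: derivableN.
  rewrite /dxx derive1E -(near_eq_derive _ (dxv_near _ _ Otx)) -derive1E.
  exact: derive1_opp.
have dx_bndv t x : 0 < t < tau -> x = l \/ x = - l ->
    derivable_in `[- l, l] (v t) x /\ dx_bnd l v t x = - dx_bnd l u t x.
  move=> tI xl; apply: derive_in_opp; last exact: (cr_dx_bnd reg).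
  by case: xl => ->; [apply: proper_within_itv_right|apply: proper_within_itv_left]; lra.
have OmegaE t x : Omega l tau (t, x) -> 0 < t < tau /\ - l <= x <= l.
  by rewrite /Omega/= !in_itv/= => -[? /andP[? ?]]; split => //; lra.
split.
- split.
  + by move=> z; apply: cvgN; exact: (cr_cont reg).
  + by move=> t x Otx; apply: derivableN; exact: (cr_dt reg).
  + by move=> t x Otx; apply: derivableN; exact: (cr_dx reg).
  + by move=> t x /dxxv[].
  + apply: (@subspace_eq_continuous _ _ _ (fun z => - dt u z.1 z.2)).
      by move=> [t x]; rewrite inE => /OmegaE[tI xI]; exact/esym/dtv.
    by move=> z; apply: cvgN; exact: (cr_dt_cont reg).
  + apply: (@subspace_eq_continuous _ _ _ (fun z => - dxx u z.1 z.2)).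
      by move=> [t x]; rewrite inE => /dxxv[_ E]; exact/esym.
    by move=> z; apply: cvgN; exact: (cr_dxx_cont reg).
  + by move=> t x tI xl; apply: derivableN; exact: (cr_dt_bnd reg).
  + by move=> t x tI /(dx_bndv _ _ tI)[].
- move=> t x Otx; have [tI xI] := OmegaE _ _ Otx.
  rewrite dtv// dxv// (dxxv _ _ Otx).2 /v !opprK -(eq _ _ Otx); lra.
- move=> t tI; rewrite dtv//; last lra.
  by rewrite (dx_bndv _ _ tI _).2 ?/v ?opprK -?bcr//; [lra|left].
- move=> t tI; rewrite dtv//; last lra.
  by rewrite (dx_bndv _ _ tI _).2 ?/v ?opprK -?bcl//; [lra|right].
Qed.

(** * From the barrier to the gradient bound *)

Lemma barrier_linear_bounds (R : realType) (psi : R -> R) (q0 q1 d : R)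
    (h h' : R -> R) :
  barrier psi q0 d h h' -> h 0 = 0 ->
  (forall s, 0 <= s <= d -> h' s <= q1) ->
  forall s, 0 <= s <= d -> q0 * s <= h s <= q1 * s.
Proof.
move=> bar h0 hq1 s /andP[s0 sd].
have dh z : 0 <= z <= s -> is_derive z 1 h (h' z).
  by move=> zI; have [|//] := bar z; lra.
have [||c] := @MVT_segment R h h' 0 s s0.
- by move=> z; rewrite in_itv/= => zI; apply: dh; lra.
- by apply: derivable_within_continuous => z; rewrite in_itv/= => /dh[].
rewrite in_itv/= h0 !subr0 => cI ->.
have [|_ _ q0h] := bar c; first lra.
have hq1c : h' c <= q1 by apply: hq1; lra.
by rewrite !ler_wpM2r.
Qed.

(** The lower linear bound on [h] dominates the initial data because [K <= q0], and [2 * M <= h d]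
    controls the oscillation; the upper linear bound turns the comparison into a slope estimate. *)
Lemma slope_controlled_dx_le (R : realType) (l tau M K q0 q1 d : R)
    (psi h h' : R -> R) (u : R -> R -> R) :
  slope_controlled l tau q0 psi u -> barrier psi q0 d h h' -> 0 < l -> 0 < d ->
  h 0 = 0 -> 2 * M <= h d -> (forall s, 0 <= s <= d -> h' s <= q1) ->
  K <= q0 ->
  (forall x y, - l <= x <= l -> - l <= y <= l ->
    `|u 0 x - u 0 y| <= K * `|x - y|) ->
  (forall t x, 0 < t < tau -> - l <= x <= l -> - M <= u t x <= M) ->
  forall t x, Omega l tau (t, x) -> dx u t x <= q1.
Proof.
move=> sc bar l0 d0 h0 hd hq1 Kq0 init uM t x Otx.
have [tI xI] : 0 < t < tau /\ - l < x < l.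
  by move: Otx; rewrite /Omega/= !in_itv/=; case.
have hlin := barrier_linear_bounds bar h0 hq1.
have cmp := slope_controlled_le_barrier sc bar l0 h0.
have {}cmp y : - l <= y -> y <= x -> x - y <= d -> u t x - u t y <= q1 * (x - y).
  move=> ly yx xyd; have /andP[_ hle] : q0 * (x - y) <= h (x - y) <= q1 * (x - y).
    by apply: hlin; lra.
  apply: (le_trans _ hle); apply: cmp => //; last lra.
    move=> x1 y1 ly1 yx1 x1l x1yd.
    have K1 : `|u 0 x1 - u 0 y1| <= K * (x1 - y1).
      by rewrite -[x1 - y1]ger0_norm ?subr_ge0//; apply: init; lra.
    have K2 : K * (x1 - y1) <= q0 * (x1 - y1) by rewrite ler_wpM2r//; lra.
    have : q0 * (x1 - y1) <= h (x1 - y1) by have /hlin/andP[] : 0 <= x1 - y1 <= d by lra.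
    by have := ler_norm (u 0 x1 - u 0 y1); lra.
  move=> s x1 y1 sI x1I y1I; have := uM _ _ sI x1I; have := uM _ _ sI y1I; lra.
have du : is_derive x 1 (u t) (dx u t x).
  by apply: DeriveDef; [exact: (cr_dx (sc_reg sc))|rewrite /dx derive1E].
have dq : is_derive x 1 (fun r : R => q1 * r + 0) q1.
  by have := @is_derive_affine R id q1 0 x 1 _; rewrite mul1r; apply.
(* By [cmp], the function [q1 * r - u t r] has a left maximum at [x]. *)
rewrite -subr_ge0; apply: left_max_derive_ge0 (is_deriveB dq du) _.
have : \forall y \near x, Num.max (- l) (x - d) < y.
  by apply: lt_nbhsr; rewrite gt_max; lra.
apply: filterS => y; rewrite gt_max => /andP[ly xdy] yx.
change (q1 * y + 0 - u t y <= q1 * x + 0 - u t x).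
by have := cmp y; lra.
Qed.

Unset Implicit Arguments.

Theorem theorem3p1 (R : realType) (M K q0 : R) (psi : R -> R)
    (M_gt0 : 0 < M) (K_ge0 : 0 <= K) (K_le_q0 : K <= q0)
    (psi_C1 : C1_ge1 psi)
    (psi_int : ((2 * M)%:E <
       \int[lebesgue_measure]_(r in `[q0, +oo[)
         (r / psi r)%:E)%E) :
  exists M1 : R,
  forall (T l : R) (a f b g : R -> R -> R -> R -> R) (u0 : R -> R),
    0 < T -> 0 < l ->
    continuous_coef l T a -> continuous_coef l T f ->
    continuous_bnd_coef l T b -> continuous_bnd_coef l T g ->
    (forall (t x z p : R), 0 <= t <= T -> - l <= x <= l -> 0 < a t x z p) ->
    (forall (t x z p : R), 0 <= t <= T -> x = l \/ x = - l -> 0 < b t x z p) ->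
    (forall (x y : R), - l <= x <= l -> - l <= y <= l ->
       `|u0 x - u0 y| <= K * `|x - y|) ->
    (forall (t x z p : R), Omegabar l T (t, x) -> - M <= z <= M ->
       `|f t x z p| <= a t x z p * psi `|p|) ->
    (forall (t z p : R), 0 < t <= T -> - M <= z <= M -> q0 <= p ->
       [/\ g t l z p <= b t l z p * p,
           - g t l z (- p) <= b t l z (- p) * p,
           - g t (- l) z p <= b t (- l) z p * p &
           g t (- l) z (- p) <= b t (- l) z (- p) * p]) ->
    forall (tau : R) (u : R -> R -> R),
      0 < tau <= T ->
      classical_solution l tau a f b g u ->
      (forall x : R, - l <= x <= l -> u 0 x = u0 x) ->
      (supnorm (Omega l tau) u <= M%:E)%E ->
      (supnorm (Omega l tau) (dx u) <= M1%:E)%E.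
Proof.
have q0_ge0 : 0 <= q0 by exact: le_trans K_le_q0.
have [q1 [d [h [h' [d0 h0 hd bar hq1]]]]] :=
  barrier_exists q0_ge0 psi_C1 psi_int.
(* The witness bounds the slope of the barrier, which was built from [M], [psi] and [q0] alone,
   before [T], [l] and the coefficients are introduced. *)
exists q1 => T l a f b g u0 T0 l0 _ _ _ _ a0 _ u0K fa gb.
move=> tau u /andP[tau0 tauT] sol uu0 uM.
have ubd := sup_bound_closure l0 (cs_reg sol) uM.
have OmegaE t x : Omega l tau (t, x) -> 0 < t < tau /\ - l < x < l.
  by rewrite /Omega/= !in_itv/=; case.
have OmegabarE t x : Omega l tau (t, x) -> Omegabar l T (t, x).
  by move=> /OmegaE[? ?]; split; rewrite /= in_itv/=; lra.
have bounded t x : Omega l tau (t, x) -> - M <= u t x <= M.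
  by move=> /OmegaE[? ?]; apply: ubd => //; lra.
have scu : slope_controlled l tau q0 psi u.
  apply: slope_controlled_solution q0_ge0 sol _ _ _.
  - by move=> t x /OmegaE[? ?]; apply/ltW/a0; lra.
  - by move=> t x Otx; apply: fa; [exact: OmegabarE|exact: bounded].
  - move=> t p tI q0p; split.
      by have [] := gb t (u t l) p _ (ubd t l tI _) q0p; lra.
    by have [] := gb t (u t (- l)) p _ (ubd t (- l) tI _) q0p; lra.
have scv : slope_controlled l tau q0 psi (fun t x => - u t x).
  apply: slope_controlled_solution q0_ge0 (classical_solution_opp l0 sol) _ _ _.
  - by move=> t x /OmegaE[? ?]; apply/ltW/a0; lra.
  - move=> t x Otx; rewrite opprK normrN -[`|dx _ t x|]normrN.
    by apply: fa; [exact: OmegabarE|exact: bounded].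
  (* For [- u] the reflected conditions are those on [g] at slope [- p], the second and fourth in
     [gb]. *)
  - move=> t p tI q0p; rewrite !opprK; split.
      by have [] := gb t (u t l) p _ (ubd t l tI _) q0p; lra.
    by have [] := gb t (u t (- l)) p _ (ubd t (- l) tI _) q0p; lra.
(* The bound [- q1 <= u_x] is rewritten as [- u_x <= q1], the upper bound for the slope of [- u]. *)
apply: ge_ereal_sup => _ [[t x] Otx <-] /=; rewrite lee_fin ler_norml lerNl.
apply/andP; split.
  rewrite -derive1_opp; last exact: (cr_dx (cs_reg sol)).
  apply: (slope_controlled_dx_le scv bar l0 d0 h0 hd hq1 K_le_q0) Otx.
    move=> y z yI zI; rewrite -opprD normrN !uu0//; exact: u0K.
  by move=> s y sI yI; have := ubd s y sI yI; lra.
apply: (slope_controlled_dx_le scu bar l0 d0 h0 hd hq1 K_le_q0) Otx => //.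
by move=> y z yI zI; rewrite !uu0//; exact: u0K.
Qed.
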